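(* Let $\mathfrak g$ be a nilpotent metric Lie algebra and suppose that $\mathfrak h$ is a totally geodesic subalgebra of $\mathfrak g$ of codimension $1$. Then $\mathfrak g$ is a direct sum of Lie ideals, $\mathfrak g\cong\mathfrak h\oplus\mathbb R$.
   Context: All Lie algebras are finite-dimensional and over $\mathbb R$. A metric Lie algebra is a Lie algebra $\mathfrak g$ equipped with an inner product $\langle\cdot,\cdot\rangle$ (arbitrary; no compatibility with the bracket is assumed). Its Levi-Civita connection $\nabla$ is given by $2\langle\nabla_XY,Z\rangle=\langle[X,Y],Z\rangle+\langle[Z,X],Y\rangle+\langle[Z,Y],X\rangle$ for all $X,Y,Z\in\mathfrak g$. A subalgebra $\mathfrak h$ of $\mathfrak g$ is totally geodesic if $\nabla_YZ\in\mathfrak h$ for all $Y,Z\in\mathfrak h$. The symbol $\oplus$ denotes the direct sum of Lie ideals, and $\mathbb R$ denotes the one-dimensional abelian Lie algebra. *)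

(* Defs.v *)
From HB Require Import structures.
From mathcomp Require Import all_boot all_order all_algebra.
From mathcomp Require Import boolp classical_sets reals ring.

Set Implicit Arguments.
Unset Strict Implicit.
Unset Printing Implicit Defensive.

Import Order.TTheory GRing.Theory Num.Theory.
Local Open Scope ring_scope.

(* Finite-dimensional Lie algebras: [vectType] carries finite dimension. *)
HB.mixin Record Vector_isLieAlgebra (R : fieldType) g of Vector R g := {
  lie : {bilinear g -> g -> g};
  liexx : forall x, lie x x = 0;
  lie_jacobi : forall x y z,
    lie x (lie y z) + lie y (lie z x) + lie z (lie x y) = 0
}.

#[short(type="lieAlgType")]
HB.structure Definition LieAlgebra (R : fieldType) :=
  {g of Vector_isLieAlgebra R g & Vector R g}.

Section LieBasics.
Context {R : fieldType} {g : lieAlgType R}.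
Implicit Types (x y : g) (U V W a b : {vspace g}).

Definition is_subalgebra U := forall x y, x \in U -> y \in U -> lie x y \in U.

Definition lie_ideal a := forall x y, y \in a -> lie x y \in a.

Definition direct_sum_of_ideals a b :=
  [/\ lie_ideal a, lie_ideal b, directv (a + b)%VS & (a + b = fullv)%VS].

Definition lie_prodv U V : {vspace g} :=
  (<<[seq lie x y | x <- vbasis U, y <- vbasis V]>>)%VS.

Lemma memv_lie U V x y : x \in U -> y \in V -> lie x y \in lie_prodv U V.
Proof.
move=> /coord_vbasis-> /coord_vbasis->.
rewrite linear_sumlz /=; apply: memv_suml => i _.
rewrite linear_sumr /=; apply: memv_suml => j _.
rewrite linearZl_LR linearZr_LR /= !memvZ // memv_span //.
by apply/allpairsP; exists ((vbasis U)`_i, (vbasis V)`_j);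
  rewrite !memt_nth.
Qed.

Lemma lie_prodvP U V W :
  reflect (forall x y, x \in U -> y \in V -> lie x y \in W)
          (lie_prodv U V <= W)%VS.
Proof.
apply: (iffP idP) => [sUVW x y Ux Vy | sUVW].
  by rewrite (subvP sUVW) // memv_lie.
apply/span_subvP => _ /allpairsP[[x y] /= [Ux Vy ->]].
by apply: sUVW; apply: vbasis_mem.
Qed.

End LieBasics.

Definition lower_central_series (R : fieldType) (g : lieAlgType R) (n : nat) :
  {vspace g} := iter n (lie_prodv fullv) fullv.

Definition lie_nilpotent (R : fieldType) (g : lieAlgType R) :=
  exists n, lower_central_series g n = 0%VS.

Definition lie_isomorphic (R : fieldType) (g1 g2 : lieAlgType R) :=
  exists2 f : {linear g1 -> g2},
    bijective f & forall x y, f (lie x y) = lie (f x) (f y).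

Record subalgebra (R : fieldType) (g : lieAlgType R) := Subalgebra {
  subalgebra_vspace :> {vspace g};
  subalgebraP : is_subalgebra subalgebra_vspace
}.

Section SubalgebraLie.
Context {R : fieldType} {g : lieAlgType R} (h : subalgebra g).

Definition subvs_lie (x y : subvs_of h) : subvs_of h :=
  Subvs (subalgebraP (valP x) (valP y)).

Lemma subvs_lie_bilinear : bilinear_for *:%R *:%R subvs_lie.
Proof.
by split=> [y | x] k u v; apply: val_inj => /=; [exact: linearPl | exact: linearPr].
Qed.

HB.instance Definition _ :=
  bilinear_isBilinear.Build R (subvs_of h) (subvs_of h) (subvs_of h)
    *:%R *:%R subvs_lie subvs_lie_bilinear.

Lemma subvs_liexx x : subvs_lie x x = 0.
Proof. by apply: val_inj; rewrite /= liexx. Qed.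

Lemma subvs_lie_jacobi x y z :
  subvs_lie x (subvs_lie y z) + subvs_lie y (subvs_lie z x)
    + subvs_lie z (subvs_lie x y) = 0.
Proof. by apply: val_inj; rewrite /= lie_jacobi. Qed.

HB.instance Definition _ :=
  Vector_isLieAlgebra.Build R (subvs_of h) subvs_liexx subvs_lie_jacobi.

End SubalgebraLie.

(* The external direct sum, with componentwise bracket. *)
Section DirectSumLie.
Context {R : fieldType} {g1 g2 : lieAlgType R}.

Definition pair_lie (x y : g1 * g2) : g1 * g2 := (lie x.1 y.1, lie x.2 y.2).

Lemma pair_lie_bilinear : bilinear_for *:%R *:%R pair_lie.
Proof.
split=> [y | x] k u v; rewrite /pair_lie /=.
  by rewrite !linearPl.
by rewrite !linearPr.
Qed.

HB.instance Definition _ :=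
  bilinear_isBilinear.Build R (g1 * g2)%type (g1 * g2)%type (g1 * g2)%type
    *:%R *:%R pair_lie pair_lie_bilinear.

Lemma pair_liexx x : pair_lie x x = 0.
Proof. by rewrite /pair_lie !liexx. Qed.

Lemma pair_lie_jacobi x y z :
  pair_lie x (pair_lie y z) + pair_lie y (pair_lie z x)
    + pair_lie z (pair_lie x y) = 0.
Proof.
by congr pair; rewrite /= lie_jacobi.
Qed.

HB.instance Definition _ :=
  Vector_isLieAlgebra.Build R (g1 * g2)%type pair_liexx pair_lie_jacobi.

End DirectSumLie.

(* The one-dimensional abelian Lie algebra. *)
Definition abelian1 (R : fieldType) : Type := R^o.

Section Abelian1.
Context {R : fieldType}.

HB.instance Definition _ := Vector.copy (abelian1 R) R^o.

Definition abelian1_lie (x y : abelian1 R) : abelian1 R := 0.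

Lemma abelian1_lie_bilinear : bilinear_for *:%R *:%R abelian1_lie.
Proof. by split=> ? k u v; rewrite /abelian1_lie /= scaler0 addr0. Qed.

HB.instance Definition _ :=
  bilinear_isBilinear.Build R (abelian1 R) (abelian1 R) (abelian1 R)
    *:%R *:%R abelian1_lie abelian1_lie_bilinear.

Lemma abelian1_liexx x : abelian1_lie x x = 0.
Proof. by []. Qed.

Lemma abelian1_lie_jacobi x y z :
  abelian1_lie x (abelian1_lie y z) + abelian1_lie y (abelian1_lie z x)
    + abelian1_lie z (abelian1_lie x y) = 0.
Proof. by rewrite /abelian1_lie !addr0. Qed.

HB.instance Definition _ :=
  Vector_isLieAlgebra.Build R (abelian1 R) abelian1_liexx abelian1_lie_jacobi.

End Abelian1.

Section LeviCivita.
Context {R : realType} {g : lieAlgType R} (ip : {dot g for idfun}).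
Implicit Types x y z w : g.

Definition koszul x y z : R :=
  ip (lie x y) z + ip (lie z x) y + ip (lie z y) x.

(* The default value [0] is never reached: see [levi_civitaP]. *)
Definition levi_civita x y : g :=
  xget 0 [set w | forall z, 2 * ip w z = koszul x y z].

Lemma dot_riesz (phi : {linear g -> R^o}) : exists w, forall z, ip w z = phi z.
Proof.
pose ipl w : 'Hom(g, R^o) := linfun (ip w : g -> R^o).
have iplE w z : ipl w z = ip w z by rewrite lfunE.
have ipl_linear : linear ipl.
  by move=> k u v; apply/lfunP => z; rewrite add_lfunE scale_lfunE !iplE linearPl.
pose iplL : {linear g -> 'Hom(g, R^o)} :=
  HB.pack ipl (GRing.isLinear.Build R g 'Hom(g, R^o) _ ipl ipl_linear).
have ker0 : lker (linfun iplL) == 0%VS.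
  rewrite -subv0; apply/subvP => w; rewrite memv_ker lfunE /= memv0 => /eqP ipw0.
  apply: contraT => /(neq0_dnorm_gt0 (s := ip)).
  by rewrite -iplE ipw0 lfunE /= ltxx.
have imgT : (limg (linfun iplL) = fullv)%VS.
  apply/eqP; rewrite eqEdim subvf /= limg_dim_eq ?(eqP ker0) ?capv0 //.
  by rewrite !dimvf /dim /= /dim /= muln1.
have: linfun phi \in limg (linfun iplL) by rewrite imgT memvf.
case/memv_imgP => w _ /lfunP phiE; exists w => z.
by rewrite -iplE -[phi z](lfunE phi) phiE (lfunE iplL).
Qed.

Lemma dot_inj w w' : (forall z, ip w z = ip w' z) -> w = w'.
Proof.
move=> eq_ww'; apply/eqP; rewrite -subr_eq0; apply: contraT.
by move/(neq0_dnorm_gt0 (s := ip)); rewrite linearBl /= eq_ww' subrr ltxx.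
Qed.

Lemma levi_civitaP x y z : 2 * ip (levi_civita x y) z = koszul x y z.
Proof.
have koszul_linear : linear (koszul x y : g -> R^o).
  move=> k u v; rewrite /koszul linearPr !linearPl /=.
  by rewrite /GRing.scale /= !mulrDr; ring.
pose phi : {linear g -> R^o} := HB.pack (koszul x y : g -> R^o)
  (GRing.isLinear.Build R g R^o _ (koszul x y : g -> R^o) koszul_linear).
have [w wE] := dot_riesz phi.
have hw : exists w, [set w | forall z, 2 * ip w z = koszul x y z]%classic w.
  exists (2^-1 *: w) => t /=.
  by rewrite linearZl_LR /= wE mulrA divff ?pnatr_eq0 // mul1r.
by have := xgetPex 0 hw; apply.
Qed.

Lemma levi_civita_unique x y w :
  (forall z, 2 * ip w z = koszul x y z) -> w = levi_civita x y.
Proof.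
move=> wE; apply: dot_inj => z; apply: (@mulfI _ 2); first by rewrite pnatr_eq0.
by rewrite wE levi_civitaP.
Qed.

Definition totally_geodesic (h : subalgebra g) :=
  forall y z, y \in (h : {vspace g}) -> z \in (h : {vspace g}) ->
    levi_civita y z \in (h : {vspace g}).

End LeviCivita.

(* Main.v *)
From HB Require Import structures.
Require Import Defs.
From mathcomp Require Import all_boot all_order all_algebra.
From mathcomp Require Import reals.
Local Open Scope ring_scope.

(** The hyperplane [h] has a nonzero normal vector [n], and the line spanned by
    [n] is a vector space complement of [h]. It remains to show that [h] is an
    ideal and that [n] is central, so that the line is an ideal too.

    - A hyperplane subalgebra of a nilpotent algebra is an ideal
      ([nilpotent_hyperplane_ideal]): for [y] in [h], [ad y] preserves [h], so
      it acts on the line [g / h] by a scalar, which is nilpotent and hence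
      zero. It follows that [ad n] maps [h] to itself.

    - By the Koszul formula, being totally geodesic means exactly that the
      [h]-part of [ad n] is skew-symmetric on [h] ([totally_geodesic_skew]):
      the term [<[y, z], n>] vanishes since [h] is a subalgebra, and what is
      left of [2 <nabla_y z, n>] is [<[n, y], z> + <[n, z], y>].

    - A skew-symmetric nilpotent endomorphism for a positive definite form is
      zero ([skew_nilpotent_eq0]). So [n] commutes with [h], and with itself.

    The isomorphism with the external sum then holds for any ideal [h] that has
    a one-dimensional complementary ideal ([direct_sum_line_isomorphic]). *)

Set Implicit Arguments.
Unset Strict Implicit.
Unset Printing Implicit Defensive.

Import Order.TTheory GRing.Theory Num.Theory.

Lemma memv_add_line (K : fieldType) (V : vectType K) (U : {vspace V})
    (v x : V) :
    (U + <[v]> = fullv)%VS ->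
  exists2 u, u \in U & exists c, x = u + c *: v.
Proof.
move=> UvT; have /memv_addP[u Uu [_ /vlineP[c ->] ->]] : x \in (U + <[v]>)%VS.
  by rewrite UvT memvf.
by exists u => //; exists c.
Qed.

Lemma hyperplane_complement (K : fieldType) (V : vectType K) (U : {vspace V})
    (v : V) :
    (\dim U).+1 = \dim {:V} -> v \notin U ->
  (U :&: <[v]> = 0)%VS /\ (U + <[v]> = fullv)%VS.
Proof.
move=> codim1 Uv; have v0 : v != 0 by apply: contraNneq Uv => ->; rewrite mem0v.
have Uv0 : (U :&: <[v]> = 0)%VS.
  apply/eqP; rewrite -subv0; apply/subvP => x /memv_capP[Ux /vlineP[c xE]].
  move: Ux; rewrite memv0 xE; have [-> | c0 Ucv] := eqVneq c 0.
    by rewrite scale0r.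
  by case/negP: Uv; rewrite -[v](scalerK c0) memvZ.
split=> //; apply/eqP; rewrite eqEdim subvf dimv_disjoint_sum //.
by rewrite dim_vline v0 addn1 codim1 leqnn.
Qed.

Section LieAlgebra.
Context {K : fieldType} {g : lieAlgType K}.
Implicit Types (x y n : g) (U a b : {vspace g}).

Lemma lie_anticomm x y : lie x y = - lie y x.
Proof.
apply/eqP; rewrite -addr_eq0; apply/eqP.
by have := liexx (x + y); rewrite linearDl /= !linearDr /= !liexx addr0 add0r.
Qed.

Lemma iter_lie_lcs k x y : iter k (lie x) y \in lower_central_series g k.
Proof. by elim: k => [|k IHk]; rewrite ?memvf // memv_lie ?memvf. Qed.

Lemma lie_nilpotent_ad :
  lie_nilpotent g -> exists k, forall x y, iter k (lie x) y = 0.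
Proof.
case=> k lcs0; exists k => x y; apply/eqP.
by rewrite -memv0 -lcs0 iter_lie_lcs.
Qed.

(** For [y] in [h], write [[y, n] = u + c n] with [u] in [h]. As [ad y]
    preserves [h], [(ad y)^j n = c^j n] modulo [h] for every [j], and the
    nilpotency of [ad y] forces [c = 0]. *)
Lemma nilpotent_hyperplane_ideal (h : subalgebra g) n :
    lie_nilpotent g -> n \notin (h : {vspace g}) -> (h + <[n]> = fullv)%VS ->
  lie_ideal h.
Proof.
move=> /lie_nilpotent_ad[k adk0] hn hnT.
have hlie y : y \in (h : {vspace g}) -> lie y n \in (h : {vspace g}).
  move=> hy; have [u hu [c yn]] := memv_add_line (lie y n) hnT.
  have iter_mod j : exists2 v, v \in (h : {vspace g}) &
      iter j (lie y) n = v + c ^+ j *: n.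
    elim: j => [|j [v hv /= ->]].
      by exists 0; rewrite ?mem0v // expr0 scale1r add0r.
    exists (lie y v + c ^+ j *: u).
      by apply: memvD; [exact: subalgebraP | exact: memvZ].
    by rewrite linearDr linearZr_LR yn scalerDr scalerA -exprSr addrA.
  have [v hv] := iter_mod k; rewrite adk0 => /esym/eqP.
  rewrite addrC addr_eq0 => /eqP ckn.
  have /eqP : c ^+ k = 0.
    apply: contraNeq hn => ck0.
    by rewrite -[n](scalerK ck0) ckn memvZ // memvN.
  by rewrite expf_eq0 => /andP[_ /eqP c0]; rewrite yn c0 scale0r addr0.
move=> x y hy; have [u hu [c ->]] := memv_add_line x hnT.
rewrite linearDl linearZl_LR /=; apply: memvD; first exact: subalgebraP.
by rewrite memvZ // lie_anticomm memvN hlie.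
Qed.

(** The bracket lies in both ideals. *)
Lemma lie_ideals_commute a b x y :
    lie_ideal a -> lie_ideal b -> (a :&: b = 0)%VS -> x \in a -> y \in b ->
  lie x y = 0.
Proof.
move=> ideal_a ideal_b ab0 ax By; apply/eqP; rewrite -memv0 -ab0 memv_cap.
by rewrite ideal_b // lie_anticomm memvN ideal_a.
Qed.

(** The isomorphism sends [x] to its component in [h] and to the coordinate of
    its component in [a] on a generator [e] of the line [a]. It preserves
    brackets because complementary ideals commute and a line is abelian. *)
Lemma direct_sum_line_isomorphic (h : subalgebra g) a :
    direct_sum_of_ideals h a -> \dim a = 1%N ->
  lie_isomorphic g (subvs_of h * abelian1 K)%type.
Proof.
case=> ideal_h ideal_a /directv_addP ha0 haT dim_a.
have [e ae] : exists e, a = <[e]>%VS.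
  have a0 : a != 0%VS by rewrite -dimv_eq0 dim_a.
  exists (vpick a); apply/esym/eqP.
  by rewrite eqEdim -memvE memv_pick dim_a dim_vline vpick0 a0.
have e0 : e != 0 by move: dim_a; rewrite ae dim_vline; case: (e != 0).
have haD x : x = daddv_pi h a x + daddv_pi a h x.
  by rewrite (daddv_pi_add ha0) // haT memvf.
have ah0 : (a :&: h = 0)%VS by rewrite capvC.
have coorde c : coord [tuple e] ord0 (c *: e) = c.
  rewrite linearZ /= -[X in coord _ _ X]/([tuple e]`_(@ord0 0)) coord_free.
    by rewrite eqxx mulr1.
  by rewrite seq1_free.
pose f x : subvs_of h * abelian1 K :=
  (vsproj h (daddv_pi h a x), coord [tuple e] ord0 (daddv_pi a h x)).
have f_linear : linear f by move=> k u v; rewrite /f !linearP.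
pose fL : {linear g -> (subvs_of h * abelian1 K)%type} :=
  HB.pack f (GRing.isLinear.Build K g (subvs_of h * abelian1 K)%type _ f f_linear).
have fE u c : u \in (h : {vspace g}) -> f (u + c *: e) = (vsproj h u, c).
  move=> hu; have aue : c *: e \in a by rewrite ae memvZ ?memv_line.
  rewrite /f !linearD /= (daddv_pi_id ha0 hu) (daddv_pi_id ah0 aue).
  have -> : daddv_pi h a (c *: e) = 0.
    apply: (addIr (daddv_pi a h (c *: e))).
    by rewrite -haD (daddv_pi_id ah0 aue) add0r.
  have -> : daddv_pi a h u = 0.
    apply: (addrI (daddv_pi h a u)).
    by rewrite -haD (daddv_pi_id ha0 hu) addr0.
  by rewrite !linear0 add0r addr0 coorde.
have heT : (h + <[e]> = fullv)%VS by rewrite -ae.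
exists fL => [|x y] /=.
  exists (fun p : subvs_of h * abelian1 K => vsval p.1 + (p.2 : K) *: e).
    by move=> x; have [u hu [c ->]] := memv_add_line x heT; rewrite fE //= vsprojK.
  by move=> [u c]; rewrite /= fE ?subvsP // vsvalK.
have [u hu [c ->]] := memv_add_line x heT.
have [v hv [d ->]] := memv_add_line y heT.
have ca k : k *: e \in a by rewrite ae memvZ ?memv_line.
have -> : lie (u + c *: e) (v + d *: e) = lie u v + 0 *: e.
  rewrite linearDl /= !linearDr /=.
  rewrite (lie_ideals_commute ideal_h ideal_a ha0 hu (ca d)).
  rewrite (lie_ideals_commute ideal_a ideal_h ah0 (ca c) hv).
  by rewrite linearZl_LR linearZr_LR /= liexx !scaler0 scale0r !addr0.
have huv : lie u v \in (h : {vspace g}) by exact: subalgebraP.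
rewrite !fE //; congr pair; apply: val_inj.
by rewrite /= !vsprojK.
Qed.

End LieAlgebra.

Section Metric.
Context {R : realType} {g : lieAlgType R} (ip : {dot g for idfun}).
Implicit Types (x y z n : g) (U V : {vspace g}).

Lemma ipC x y : ip x y = ip y x.
Proof. by rewrite hermC expr0 mul1r. Qed.

Lemma ip_eq0 x : ip x x = 0 -> x = 0.
Proof.
move=> ipx0; apply: contraTeq isT => /(neq0_dnorm_gt0 (s := ip)).
by rewrite ipx0 ltxx.
Qed.

(** For [v] outside [V], the vector [u = v - projv V v] is nonzero and killed by
    the projection [projv V] (whose kernel is some complement of [V], in general
    not the orthogonal one). So the linear form [z |-> <u, z - projv V z>]
    vanishes on [V] but not at [u], and its Riesz representative is a normal
    vector. *)
Lemma exists_normal V :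
  V != fullv -> exists2 n, n != 0 & {in V, forall y, ip n y = 0}.
Proof.
move=> VnT; have [v Vv] : exists v, v \notin V.
  have /subvPn[v _ Vv] : ~~ (fullv <= V)%VS.
    by apply: contraNN VnT => fV; rewrite eqEsubv subvf.
  by exists v.
pose u := v - projv V v.
have u0 : u != 0.
  by apply: contraNneq Vv => /eqP; rewrite subr_eq0 => /eqP->; rewrite memv_proj.
have phi_linear : linear (fun z => ip u (z - projv V z) : R^o).
  by move=> k y z; rewrite linearP opprD addrACA -scalerBr linearPr.
pose phi : {linear g -> R^o} := HB.pack (fun z => ip u (z - projv V z) : R^o)
  (GRing.isLinear.Build R g R^o _ (fun z => ip u (z - projv V z) : R^o) phi_linear).
have [n nE] := dot_riesz ip phi; exists n => [|y Vy]; last first.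
  by rewrite nE /= projv_id // subrr linear0r.
apply: contraNneq u0 => n0; apply/eqP/ip_eq0.
have pu0 : projv V u = 0 by rewrite linearB /= projv_proj subrr.
by have := nE u; rewrite n0 linear0l /= pu0 subr0.
Qed.

(** If [A (A y) = 0] then [<A y, A y> = - <y, A (A y)> = 0]; so
    [A^(k+2) y = 0] implies [A^(k+1) y = 0], down to [A y = 0]. *)
Lemma skew_nilpotent_eq0 V (A : {linear g -> g}) :
    {in V, forall y, A y \in V} ->
    {in V &, forall y z, ip (A y) z = - ip y (A z)} ->
  forall k y, y \in V -> iter k A y = 0 -> A y = 0.
Proof.
move=> AV skewA; elim=> [|k IHk] y Vy; first by move=> /= ->; rewrite linear0.
rewrite iterSr => Aky0; have AAy0 := IHk _ (AV _ Vy) Aky0.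
by apply: ip_eq0; rewrite skewA ?AV // AAy0 linear0r oppr0.
Qed.

(** For [y], [z] in [h], only the two terms of the Koszul formula for
    [2 <nabla_y z, n> = 0] in which [ad n] occurs can be nonzero. *)
Lemma totally_geodesic_skew (h : subalgebra g) n :
    totally_geodesic ip h -> {in (h : {vspace g}), forall y, ip n y = 0} ->
  {in (h : {vspace g}) &, forall y z, ip (lie n y) z = - ip y (lie n z)}.
Proof.
move=> tgh nh y z hy hz; have hyz : lie y z \in (h : {vspace g}).
  exact: subalgebraP.
have := levi_civitaP ip y z n.
rewrite /koszul ipC nh ?tgh // mulr0 [ip (lie y z) n]ipC nh // add0r.
by move/esym/eqP; rewrite addr_eq0 [ip (lie n z) y]ipC => /eqP.
Qed.

End Metric.

Theorem proposition1p13 (R : realType) (g : lieAlgType R)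
    (ip : {dot g for idfun}) (h : subalgebra g) :
  lie_nilpotent g ->
  totally_geodesic ip h ->
  (\dim h).+1 = \dim {: g} ->
  (exists a : {vspace g}, direct_sum_of_ideals h a /\ \dim a = 1%N) /\
  lie_isomorphic g (subvs_of h * abelian1 R)%type.
Proof.
move=> nil_g tgh codim1.
suff [a [ha dim_a]] : exists a, direct_sum_of_ideals h a /\ \dim a = 1%N.
  by split; [exists a | apply: direct_sum_line_isomorphic ha dim_a].
have [|n n0 nh] := @exists_normal _ _ ip h.
  by apply/eqP => hT; move: codim1; rewrite hT => /esym/n_Sn.
have hn : n \notin (h : {vspace g}).
  by apply: contraNN n0 => hn; apply/eqP/(@ip_eq0 _ _ ip)/nh.
have [hn0 hnT] := hyperplane_complement codim1 hn.
have ideal_h := nilpotent_hyperplane_ideal nil_g hn hnT.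
have nh0 y : y \in (h : {vspace g}) -> lie n y = 0.
  have [k adk0] := lie_nilpotent_ad nil_g.
  move=> hy; apply: (@skew_nilpotent_eq0 _ _ ip h (lie n) _ _ k) => //.
  - by move=> z; apply: ideal_h.
  - exact: totally_geodesic_skew tgh nh.
  - exact: adk0.
have central x : lie x n = 0.
  have [u hu [c ->]] := memv_add_line x hnT.
  by rewrite linearDl linearZl_LR /= liexx scaler0 addr0 lie_anticomm nh0 ?oppr0.
exists <[n]>%VS; split; last by rewrite dim_vline n0.
split=> //; last exact/directv_addP.
by move=> x _ /vlineP[c ->]; rewrite linearZr_LR /= central scaler0 mem0v.
Qed.
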